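(* Let $\xi=(G,\mathcal{L},\mathcal{A})$ be a triplet whose multigraph $G$ is not strongly connected, and let $G=\bigsqcup_{i=1}^r G_i$ be a disjoint partition of its vertices such that each submultigraph $G_i$ is strongly connected and $G_i$ is not reachable from $G_j$ whenever $i>j$ (such a partition exists). Let $\xi_i$ be the restriction of $\xi$ to $G_i$. Then $$\rho(\xi)=\max\{\rho(\xi_1),\dots,\rho(\xi_r)\}.$$
   Context: A triplet (system) $\xi=(G,\mathcal{L},\mathcal{A})$ consists of: a finite directed multigraph $G$ with vertices $1,\dots,n$ (loops and multiple edges allowed, finitely many edges); real linear spaces $\mathcal{L}=(L_1,\dots,L_n)$ with $1\le\dim L_i<\infty$, $L_i$ attached to vertex $i$; and, for every edge from $i$ to $j$, a linear operator $A_{ji}:L_i\to L_j$. $\mathcal{A}$ is the family of all these operators. The restriction of $\xi$ to a set of vertices consists of these vertices with their spaces, all edges of $G$ connecting vertices of this set, and the operators of those edges. A multigraph is strongly connected if for every pair of distinct vertices there is a path from one to the other (in both directions); a single vertex is strongly connected. A path $\alpha$ is a sequence of consecutive edges; $|\alpha|$ is its number of edges. For a path $i_1\to i_2\to\dots\to i_{k+1}$ with operators $A_{i_{s+1}i_s}$, $\Pi_\alpha=A_{i_{k+1}i_k}\cdots A_{i_2i_1}:L_{i_1}\to L_{i_{k+1}}$. A multinorm is a collection of norms $\|\cdot\|_i$ on $L_i$, $i=1,\dots,n$; for an operator $A:L_i\to L_j$, $\|A\|=\sup_{\|x\|_i=1}\|Ax\|_j$. The joint spectral radius is $\rho(\xi)=\lim_{k\to\infty}\max_{|\alpha|=k}\|\Pi_\alpha\|^{1/k}$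 (the limit exists and does not depend on the multinorm; a maximum over an empty set is $0$). *)

(* Defs.v *)
From HB Require Import structures.
From mathcomp Require Import all_boot all_order all_algebra.
From mathcomp Require Import all_classical all_reals all_analysis.

Set Implicit Arguments.
Unset Strict Implicit.
Unset Printing Implicit Defensive.

Import Order.TTheory GRing.Theory Num.Theory.
Import numFieldNormedType.Exports.

Local Open Scope classical_set_scope.
Local Open Scope ring_scope.

(* The vertices form an arbitrary finite type rather than {1, ..., n}, so that
   a restriction to a set of vertices is again a system.  Distinct elements of
   the edge type may share source and target. *)
Record system (R : realType) := System {
  vertex : finType;
  edge : finType;
  src : edge -> vertex;
  tgt : edge -> vertex;
  vertex_space : vertex -> vectType R;
  vertex_space_dim : forall v, (0 < \dim {:vertex_space v})%N;
  operator : forall e, 'Hom(vertex_space (src e), vertex_space (tgt e)) }.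

Section Systems.
Variable R : realType.
Implicit Type xi : system R.

Definition edge_rel xi : rel (vertex xi) :=
  [rel u v | [exists e : edge xi, (src e == u) && (tgt e == v)]].

Definition reachable xi (u v : vertex xi) : bool := connect (@edge_rel xi) u v.

Definition strongly_connected xi : Prop :=
  forall u v : vertex xi, u != v -> reachable u v /\ reachable v u.

Section Restriction.
Variables (xi : system R) (S : {set vertex xi}).

Definition inner_edge : finType :=
  {e : edge xi | (src e \in S) && (tgt e \in S)}.

Definition restriction_src (e : inner_edge) : {v : vertex xi | v \in S} :=
  exist _ (src (val e)) (proj1 (andP (valP e))).

Definition restriction_tgt (e : inner_edge) : {v : vertex xi | v \in S} :=
  exist _ (tgt (val e)) (proj2 (andP (valP e))).

Definition restriction : system R :=
  @System R {v : vertex xi | v \in S} inner_edge restriction_src restriction_tgt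
    (fun v => vertex_space (val v)) (fun v => vertex_space_dim (val v))
    (fun e => operator (val e)).

End Restriction.

(* The last condition reads: [P i] is not reachable from [P j] if j < i. *)
Definition ordered_scc_partition xi (r : nat) (P : 'I_r -> {set vertex xi}) :
    Prop :=
  [/\ forall i, P i != finset.set0,
      forall i j, i != j -> (P i :&: P j)%SET = finset.set0,
      (\bigcup_(i < r) P i)%SET = [set: vertex xi]%SET,
      forall i, strongly_connected (restriction (P i)) &
      forall i j : 'I_r, (j < i)%N ->
        forall u v, u \in P j -> v \in P i -> ~~ reachable u v].

(* A path from [u] to [v]; its operator is the product of the operators of its
   edges, the first edge being applied first. *)
Inductive walk xi : vertex xi -> vertex xi -> Type :=
| walk_nil (v : vertex xi) : walk v v
| walk_cons (e : edge xi) (v : vertex xi) :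
    walk (tgt e) v -> walk (src e) v.

Fixpoint walk_size xi (u v : vertex xi) (p : walk u v) : nat :=
  match p with
  | walk_nil _ => 0
  | walk_cons _ _ p' => (walk_size p').+1
  end.

Fixpoint walk_op xi (u v : vertex xi) (p : walk u v) :
    'Hom(vertex_space u, vertex_space v) :=
  match p with
  | walk_nil v => \1%VF
  | walk_cons e v p' => (walk_op p' \o operator e)%VF
  end.

Record norm_on (V : lmodType R) := NormOn {
  norm_fun :> V -> R;
  norm_fun_triangle : forall x y, norm_fun (x + y) <= norm_fun x + norm_fun y;
  norm_fun_scale : forall (a : R) x, norm_fun (a *: x) = `|a| * norm_fun x;
  norm_fun_eq0 : forall x, norm_fun x = 0 -> x = 0 }.

Definition multinorm xi := forall v : vertex xi, norm_on (vertex_space v).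

Definition opnorm (U V : vectType R) (NU : norm_on U) (NV : norm_on V)
    (A : 'Hom(U, V)) : R :=
  sup [set NV (A x) | x in [set x | NU x = 1]].

(* There are finitely many walks of length [k], so the supremum is a maximum;
   [sup set0 = 0] covers the case where there is none. *)
Definition max_walk_norm xi (nu : multinorm xi) (k : nat) : R :=
  sup [set x | exists (u v : vertex xi) (p : walk u v),
         walk_size p = k /\ x = opnorm (nu u) (nu v) (walk_op p)].

(* The sequence converges because [max_walk_norm nu] is submultiplicative.  Its
   term of index 0 is immaterial. *)
Definition joint_spectral_radius xi (nu : multinorm xi) : R :=
  limn (fun k : nat => max_walk_norm nu k `^ (k%:R)^-1).

End Systems.

(* Main.v *)
Require Import Defs.
From HB Require Import structures.
From mathcomp Require Import all_boot all_order all_algebra.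
From mathcomp Require Import all_classical all_reals all_analysis.

Set Implicit Arguments.
Unset Strict Implicit.
Unset Printing Implicit Defensive.

Import Order.TTheory GRing.Theory Num.Theory.
Import numFieldNormedType.Exports.
Import VectorInternalTheory.
Local Open Scope classical_set_scope.
Local Open Scope ring_scope.

(** The joint spectral radius is the infimum of the rates [q > 0] admitting a
    weight, that is, a function [w] on the vectors of every vertex space which
    is comparable to the norms and which every edge operator multiplies by at
    most [q] ([joint_spectral_radius_le], [contracting_weight_exists]).  If
    [rho < q], such a weight is obtained by letting [w v x] be the supremum of
    [nu (walk_op p x) / q ^+ walk_size p] over the walks [p] leaving [v]; it
    is finite because [max_walk_norm nu k = O(q ^+ k)].  Conversely, a weight
    of rate [q] bounds all walks of length [k] by a constant times [q ^+ k].

    This description does not mention walks, and it makes the theorem a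
    statement about single edges.  A weight for the system restricts to each
    part, whence [rho(xi_i) <= rho(xi)].  Given weights of the same rate [q] on
    all the parts, give the weight of the [i]-th part the factor [t ^+ i].
    Edges inside a part are unaffected, and an edge between two parts lowers
    the index, so it gains a factor [t^-1], which beats the norm of its
    operator once [t] is large ([contracting_weight_glue]).  Hence
    [rho(xi) <= q] as soon as [q] exceeds every [rho(xi_i)].

    Two classical facts support this.  All norms on a finite-dimensional space
    are equivalent ([seminorm_le_norm]), so operators are bounded and the
    existence of a weight of rate [q] does not depend on the multinorm.  And
    the [k]-th roots of a submultiplicative sequence converge, with a limit
    which is their infimum (Fekete), so the limit defining the joint spectral
    radius exists.

    For the existence of the partition, the classes of mutual reachability are
    sorted by the number of vertices that can be reached from them: this number
    drops strictly along a path that leaves a class. *)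

(** * Equivalence of norms in finite dimension *)

Section Seminorms.
Variable R : realType.

Definition seminorm (V : lmodType R) (p : V -> R) : Prop :=
  (forall x y, p (x + y) <= p x + p y) /\
  (forall a x, p (a *: x) = `|a| * p x).

Lemma norm_on_seminorm (V : lmodType R) (N : norm_on V) : seminorm N.
Proof. by split; [exact: norm_fun_triangle | exact: norm_fun_scale]. Qed.

Section SeminormTheory.
Variables (V : lmodType R) (p : V -> R).
Hypothesis sp : seminorm p.

Lemma seminorm0 : p 0 = 0.
Proof. by rewrite -(scale0r (0 : V)) sp.2 normr0 mul0r. Qed.

Lemma seminormN x : p (- x) = p x.
Proof. by rewrite -scaleN1r sp.2 normrN1 mul1r. Qed.

Lemma seminorm_ge0 x : 0 <= p x.
Proof.
have: p (x - x) <= p x + p (- x) by exact: sp.1.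
by rewrite subrr seminorm0 seminormN -mulr2n pmulrn_lge0.
Qed.

Lemma seminorm_sum (I : Type) (s : seq I) (F : I -> V) :
  p (\sum_(i <- s) F i) <= \sum_(i <- s) p (F i).
Proof.
elim/big_rec2: _ => [|i y x _ le_xy]; first by rewrite seminorm0.
by apply: le_trans (sp.1 _ _) _; rewrite lerD2l.
Qed.

Lemma seminorm_dist x y : `|p x - p y| <= p (x - y).
Proof.
rewrite ler_norml; apply/andP; split.
  rewrite lerNl opprB lerBlDr -[p (x - y)]seminormN opprB.
  by rewrite -{1}(subrK x y) sp.1.
by rewrite lerBlDr -{1}(subrK y x) sp.1.
Qed.

End SeminormTheory.

Lemma seminorm_comp (U V : vectType R) (N : norm_on V) (A : 'Hom(U, V)) :
  seminorm (fun x => N (A x)).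
Proof.
have [NT NZ] := norm_on_seminorm N.
by split=> [x y|a x]; rewrite ?linearD ?linearZ ?NT ?NZ.
Qed.

Lemma seminorm_le_mx_norm n (p : 'rV[R]_n -> R) :
  seminorm p -> exists2 C : R, 0 < C & forall x, p x <= C * `|x|.
Proof.
move=> sp; exists (1 + \sum_(j < n) p (delta_mx 0 j)) => [|x].
  by rewrite ltr_pwDl// sumr_ge0// => j _; exact: seminorm_ge0.
rewrite {1}(row_sum_delta x); apply: le_trans (seminorm_sum sp _ _) _.
rewrite mulrDl mul1r.
apply: (@le_trans _ _ ((\sum_(j < n) p (delta_mx 0 j)) * `|x|)).
  rewrite mulr_suml; apply: ler_sum => j _; rewrite sp.2 mulrC.
  apply: ler_wpM2l; first exact: seminorm_ge0.
  rewrite [leRHS]mx_normrE.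
  exact: (le_bigmax _ (fun ij => `|x ij.1 ij.2|) (ord0, j)).
by rewrite lerDr.
Qed.

(** The seminorm is Lipschitz, hence continuous, and it attains a minimum on
    the compact unit sphere; being definite, this minimum is positive. *)
Lemma norm_ge_mx_norm n (p : 'rV[R]_n -> R) :
  seminorm p -> (forall x, p x = 0 -> x = 0) ->
  exists2 c : R, 0 < c & forall x, c * `|x| <= p x.
Proof.
move=> sp p_def.
pose S := [set x : 'rV[R]_n | `|x| = 1]%classic.
have scaleS x : x != 0 -> S (`|x|^-1 *: x).
  move=> x0; rewrite /S /= normrZ normfV normr_id mulVf//.
  by rewrite normr_eq0.
suff [c c0 cS] : exists2 c : R, 0 < c & forall x, S x -> c <= p x.
  exists c => // x; have [->|x0] := eqVneq x 0.
    by rewrite normr0 mulr0 (seminorm_ge0 sp).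
  have := cS _ (scaleS x x0).
  by rewrite sp.2 normfV normr_id mulrC ler_pdivlMr// normr_gt0.
(* An empty sphere, [n = 0], has no minimum. *)
have [S0|/set0P S_neq0] := eqVneq S set0%classic.
  by exists 1 => // x; rewrite S0.
have [C C0 pC] := seminorm_le_mx_norm sp.
have p_cont : continuous p.
  move=> x; apply/(@cvgrPdist_le _ _ _ (nbhs x)) => e e0; near=> y.
  apply: le_trans (seminorm_dist sp _ _) _; apply: le_trans (pC _) _.
  rewrite mulrC -ler_pdivlMr//; near: y.
  have : (id @ x --> x)%classic by exact: cvg_id.
  by move/cvgr_dist_le; apply; exact: divr_gt0.
have S_compact : compact S.
  apply: bounded_closed_compact.
    exists 1; split; first exact: real1.
    by move=> M M1 x /= ->; exact: ltW.
  rewrite (_ : S = (fun x => `|x|) @^-1` [set 1 : R])%classic//.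
  apply: preimage_closed (@closed_eq R 1) => x _.
  exact: norm_continuous.
have [c Sc c_min] := EVT_min_rV S_neq0 S_compact (continuous_subspaceT p_cont).
move: Sc; rewrite inE /S /= => c1.
exists (p c) => [|x Sx]; last by apply: c_min; rewrite inE.
rewrite lt_neqAle (seminorm_ge0 sp) andbT eq_sym; apply/eqP => /p_def c_eq0.
by move/eqP: c1; rewrite c_eq0 normr0 eq_sym oner_eq0.
Unshelve. all: by end_near. Qed.

(** Applied to [x |-> N' (A x)], this gives both the boundedness of linear maps
    and, with [A] the identity, the equivalence of norms. *)
Lemma seminorm_le_norm (V : vectType R) (N : norm_on V) (p : V -> R) :
  seminorm p -> exists2 C : R, 0 < C & forall x, p x <= C * N x.
Proof.
move=> sp; have sN := norm_on_seminorm N.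
have seminorm_r2v (f : V -> R) :
    seminorm f -> seminorm (fun x : 'rV_(dim V) => f (r2v x)).
  by move=> sf; split=> [x y|a x]; rewrite ?linearD ?linearZ ?sf.1 ?sf.2.
have [C C0 pC] := seminorm_le_mx_norm (seminorm_r2v _ sp).
have [|c c0 Nc] := norm_ge_mx_norm (seminorm_r2v _ sN).
  by move=> x /norm_fun_eq0 x0; apply: (can_inj r2vK); rewrite x0 linear0.
exists (C / c) => [|x]; first exact: divr_gt0.
rewrite -(v2rK x); apply: le_trans (pC _) _.
by rewrite -mulrA ler_pM2l// ler_pdivlMl.
Qed.

End Seminorms.

(** * Roots of a submultiplicative sequence *)

Section Fekete.
Variables (R : realType) (a : nat -> R).
Hypothesis a_ge0 : forall n, 0 <= a n.
Hypothesis a_submul : forall m n, a (m + n)%N <= a m * a n.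

Let root n := a n `^ n%:R^-1.

Lemma root_leP n q : (0 < n)%N -> 0 <= q -> (root n <= q) = (a n <= q ^+ n).
Proof.
move=> n0 q0; have n_neq0 : n%:R != 0 :> R by rewrite pnatr_eq0 -lt0n.
have root_a : root n ^+ n = a n.
  by rewrite -powR_mulrn ?powR_ge0// -powRrM mulVf// powRr1.
by rewrite -root_a ler_pXn2r// nnegrE powR_ge0.
Qed.

Lemma submul_expn m k : a (m * k)%N <= a k ^+ m * a 0%N.
Proof.
elim: m => [|m IHm]; first by rewrite mul0n expr0 mul1r.
rewrite mulSn exprS -mulrA; apply: le_trans (a_submul _ _) _.
exact: ler_wpM2l.
Qed.

(** Euclidean division of [n] by [k] reduces [a n] to a power of [a k] and to
    one of finitely many remainders.  The factor [a 0] comes from stopping the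
    expansion of [a (m * k)] at [m = 0]. *)
Lemma submul_growth k q : (0 < k)%N -> 0 < q -> a k <= q ^+ k ->
  exists2 D : R, 0 < D & forall n, a n <= D * q ^+ n.
Proof.
move=> k0 q0 ak.
pose M : R := \big[Num.max/1]_(r < k) (a r / q ^+ r).
have M1 : 1 <= M by exact: bigmax_ge_id.
have a0_ge0 := a_ge0 0%N.
exists ((a 0%N + 1) * M) => [|n].
  by rewrite mulr_gt0 ?ltr_wpDl// (lt_le_trans _ M1).
have r_lt : (n %% k < k)%N by rewrite ltn_mod.
rewrite {1 2}(divn_eq n k); set m := (n %/ k)%N; set r := (n %% k)%N.
have ar : a r <= M * q ^+ r.
  rewrite -ler_pdivrMr ?exprn_gt0//.
  exact: (le_bigmax 1 (fun i : 'I_k => a i / q ^+ i) (Ordinal r_lt)).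
apply: le_trans (a_submul _ _) _.
have am : a (m * k)%N <= (a 0%N + 1) * q ^+ (m * k).
  apply: le_trans (submul_expn _ _) _; rewrite mulrC mulnC exprM.
  apply: ler_pM => //; first exact: exprn_ge0.
    by rewrite lerDl.
  by rewrite lerXn2r// nnegrE ?exprn_ge0// ltW.
rewrite exprD mulrACA; exact: ler_pM.
Qed.

(** The constant [D] is absorbed by the geometric growth of [(q' / q) ^+ n]. *)
Lemma growth_root_le q q' D : 0 < q -> q < q' -> 0 < D ->
  (forall n, a n <= D * q ^+ n) -> \forall n \near \oo, root n <= q'.
Proof.
move=> q0 qq' D0 aD; have q'0 := lt_trans q0 qq'.
have quot_lt1 : `|q / q'| < 1.
  by rewrite ger0_norm ?divr_ge0 ?ltW// ltr_pdivrMr// mul1r.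
have Dinv0 : 0 < D^-1 by rewrite invr_gt0.
near=> n; rewrite root_leP//; last 2 first.
- by near: n; exact: nbhs_infty_gt.
- exact: ltW.
apply: le_trans (aD n) _.
rewrite -ler_pdivlMl// -ler_pdivrMr ?exprn_gt0// -expr_div_n.
by near: n; apply: (cvgr_le _ (cvg_expr quot_lt1)).
Unshelve. all: by end_near. Qed.

(** The limit is the infimum [inf E] of the roots: a root below
    [inf E + e / 2] forces growth at this rate, and so keeps all late roots
    below [inf E + e]. *)
Lemma cvg_root : cvgn root.
Proof.
pose E := [set root n | n in [set n | 0 < n]%N]%classic.
have E0 : (E !=set0)%classic by exists (root 1); exists 1%N.
have E_ge0 : lbound E 0 by move=> _ [n _ <-]; exact: powR_ge0.
have E_inf : has_inf E by split=> //; exists 0.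
have inf_ge0 : 0 <= inf E by exact: lb_le_inf.
apply/cvg_ex; exists (inf E); apply/cvgrPdist_le => /= e e0.
have e2 : 0 < e / 2 by exact: divr_gt0.
have [_ [k k0 <-] root_k] := inf_adherent e2 E_inf.
have q0 : 0 < inf E + e / 2 by rewrite ltr_wpDl.
have [||D D0 aD] := @submul_growth k (inf E + e / 2) k0; first by [].
  by rewrite -root_leP// ltW.
have q'q : inf E + e / 2 < inf E + e.
  by rewrite ltrD2l ltr_pdivrMr// ltr_pMr// ltr1n.
near=> n; rewrite ler_distlC; apply/andP; split.
  apply: (@le_trans _ _ (inf E)); first by rewrite gerBl ltW.
  apply: ge_inf; first by exists 0.
  by exists n => //=; near: n; exact: nbhs_infty_gt.
by near: n; exact: growth_root_le aD.
Unshelve. all: by end_near. Qed.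

Lemma lim_root_ge0 : 0 <= limn root.
Proof.
by apply: limr_ge; [exact: cvg_root | apply: nearW => n; exact: powR_ge0].
Qed.

Lemma lim_root_le q D : 0 < q -> 0 < D ->
  (forall n, a n <= D * q ^+ n) -> limn root <= q.
Proof.
move=> q0 D0 aD; apply/ler_addgt0Pr => e e0; apply: limr_le cvg_root _.
by apply: growth_root_le aD => //; rewrite ltrDl.
Qed.

Lemma lim_root_lt q : limn root < q ->
  exists2 D : R, 0 < D & forall n, a n <= D * q ^+ n.
Proof.
move=> lim_q; have q0 := le_lt_trans lim_root_ge0 lim_q.
have root_lt : \forall n \near \oo, root n < q.
  exact: (cvgr_lt _ cvg_root).
near \oo => n; have n0 : (0 < n)%N by near: n; exact: nbhs_infty_gt.
apply: (@submul_growth n) => //; rewrite -root_leP// ltW//.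
by near: n.
Unshelve. all: by end_near. Qed.

End Fekete.

(** * Operator norms and walks *)

Lemma sup_ge0 (R : realType) (E : set R) :
  (forall x, E x -> 0 <= x) -> 0 <= sup E.
Proof.
move=> E_ge0; have [[[x Ex] E_ub]|/sup_out->//] := pselect (has_sup E).
by apply: le_trans (E_ge0 x Ex) _; exact: ub_le_sup.
Qed.

Section OperatorNorm.
Variables (R : realType) (U V : vectType R) (NU : norm_on U) (NV : norm_on V).
Variable A : 'Hom(U, V).

Let sU := norm_on_seminorm NU.
Let sA := seminorm_comp NV A.

Lemma opnormP x : NV (A x) <= opnorm NU NV A * NU x.
Proof.
have [->|x0] := eqVneq x 0.
  by rewrite (seminorm0 sA) (seminorm0 sU) mulr0.
have NUx : 0 < NU x.
  rewrite lt_neqAle (seminorm_ge0 sU) andbT eq_sym.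
  by apply/eqP => /norm_fun_eq0 /eqP; rewrite (negPf x0).
rewrite -ler_pdivrMr// mulrC.
have NUx1 : `|(NU x)^-1| = (NU x)^-1 by rewrite ger0_norm// invr_ge0 ltW.
have -> : (NU x)^-1 * NV (A x) = NV (A ((NU x)^-1 *: x)).
  by rewrite sA.2 NUx1.
apply: ub_le_sup.
  have [C C0 AC] := seminorm_le_norm NU sA.
  by exists C => _ [y /= y1 <-]; apply: le_trans (AC y) _; rewrite y1 mulr1.
by exists ((NU x)^-1 *: x) => //=; rewrite sU.2 NUx1 mulVf// gt_eqF.
Qed.

Lemma opnorm_le C : 0 <= C -> (forall x, NV (A x) <= C * NU x) ->
  opnorm NU NV A <= C.
Proof.
move=> C0 AC; rewrite /opnorm; set E := (X in sup X).
have [->|/set0P E0] := eqVneq E set0; first by rewrite sup0.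
apply: ge_sup => // _ [y /= y1 <-]; apply: le_trans (AC y) _.
by rewrite y1 mulr1.
Qed.

Lemma opnorm_ge0 : 0 <= opnorm NU NV A.
Proof. by apply: sup_ge0 => _ [y _ <-]; exact: (seminorm_ge0 sA). Qed.

End OperatorNorm.

Lemma uniform_constant (R : realType) (I : finType) (P : I -> R -> Prop) :
  (forall i C C', C <= C' -> P i C -> P i C') ->
  (forall i, exists2 C, 0 < C & P i C) ->
  exists2 C, 0 < C & forall i, P i C.
Proof.
move=> P_mono P_ex.
have /choice[C PC] : forall i, exists C, 0 < C /\ P i C.
  by move=> i; have [C C0 PC] := P_ex i; exists C.
exists (\big[Num.max/1]_i C i) => [|i].
  exact: lt_le_trans (bigmax_ge_id _ _ _ _).
by apply: P_mono (PC i).2; exact: le_bigmax.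
Qed.

Section Walks.
Variables (R : realType) (xi : system R).

Lemma walk_split (u v : vertex xi) (p : walk u v) (m n : nat) :
  walk_size p = (m + n)%N ->
  exists (s : vertex xi) (p1 : walk u s) (p2 : walk s v),
    [/\ walk_size p1 = m, walk_size p2 = n &
      forall x, walk_op p x = walk_op p2 (walk_op p1 x)].
Proof.
elim: p m => [{}v|e {}v p IHp] [|m] //= sz.
- exists v, (walk_nil v), (walk_nil v); split=> //= x.
  by rewrite !id_lfunE.
- exists (src e), (walk_nil (src e)), (walk_cons p); split=> //= x.
  by rewrite id_lfunE.
- have [|s [p1 [p2 [sz1 sz2 p12]]]] := IHp m; first by case: sz.
  exists s, (walk_cons p1), p2; split=> //=; first by rewrite sz1.
  by move=> x; rewrite !comp_lfunE p12.
Qed.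

Variable nu : multinorm xi.

Let nu_ge0 v x : 0 <= nu v x.
Proof. exact: seminorm_ge0 (norm_on_seminorm _) _. Qed.

Lemma edges_bounded :
  exists2 B : R, 0 < B & forall (e : edge xi) x,
    nu (tgt e) (operator e x) <= B * nu (src e) x.
Proof.
apply: uniform_constant => [e C C' CC' BC x|e].
  by apply: le_trans (BC x) _; exact: ler_wpM2r.
exact: seminorm_le_norm (seminorm_comp _ _).
Qed.

Lemma walks_bounded : exists2 B : R, 0 < B &
  forall (u v : vertex xi) (p : walk u v) x,
    nu v (walk_op p x) <= B ^+ walk_size p * nu u x.
Proof.
have [B B0 edgeB] := edges_bounded; exists B => // u v.
elim=> [{}v|e {}v p IHp] x /=; first by rewrite id_lfunE expr0 mul1r.
rewrite comp_lfunE exprSr -mulrA; apply: le_trans (IHp _) _.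
by rewrite ler_pM2l ?exprn_gt0.
Qed.

Lemma max_walk_norm_ge0 k : 0 <= max_walk_norm nu k.
Proof. by apply: sup_ge0 => _ [u [v [p [_ ->]]]]; exact: opnorm_ge0. Qed.

Lemma max_walk_normP (u v : vertex xi) (p : walk u v) x :
  nu v (walk_op p x) <= max_walk_norm nu (walk_size p) * nu u x.
Proof.
apply: le_trans (opnormP (nu u) _ _ _) _; apply: ler_wpM2r => //.
apply: ub_le_sup; last by exists u, v, p.
have [B B0 walkB] := walks_bounded; exists (B ^+ walk_size p).
move=> _ [u' [v' [p' [sz ->]]]]; apply: opnorm_le; first exact/exprn_ge0/ltW.
by move=> y; rewrite -sz.
Qed.

Lemma max_walk_norm_le k C : 0 <= C ->
  (forall (u v : vertex xi) (p : walk u v) x,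
     walk_size p = k -> nu v (walk_op p x) <= C * nu u x) ->
  max_walk_norm nu k <= C.
Proof.
move=> C0 walkC; rewrite /max_walk_norm; set E := (X in sup X).
have [->|/set0P E0] := eqVneq E set0; first by rewrite sup0.
apply: ge_sup => // _ [u [v [p [sz ->]]]].
by apply: opnorm_le => // x; exact: walkC.
Qed.

Lemma max_walk_norm_submul m n :
  max_walk_norm nu (m + n) <= max_walk_norm nu m * max_walk_norm nu n.
Proof.
apply: max_walk_norm_le => [|u v p x].
  by rewrite mulr_ge0// max_walk_norm_ge0.
case/walk_split => s [p1 [p2 [<- <- ->]]].
apply: le_trans (max_walk_normP _ _) _; rewrite [leRHS]mulrAC [leRHS]mulrC.
by apply: ler_wpM2l; [exact: max_walk_norm_ge0 | exact: max_walk_normP].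
Qed.

(** * Contracting weights and the joint spectral radius *)

(** This is a Lyapunov function, or extremal norm, of rate [q].  It need not be
    a norm: being sandwiched between multiples of the norms is all that the
    estimates require, and it lets suprema over walks serve as weights. *)
Definition contracting_weight (q : R) : Prop :=
  exists w : forall v : vertex xi, vertex_space v -> R,
    (exists2 C, 0 < C & forall v x, nu v x <= w v x <= C * nu v x) /\
    (forall e x, w (tgt e) (operator e x) <= q * w (src e) x).

Lemma joint_spectral_radius_ge0 : 0 <= joint_spectral_radius nu.
Proof.
exact: lim_root_ge0 max_walk_norm_ge0 max_walk_norm_submul.
Qed.

(** Along a walk of length [k] the weight grows at most by [q ^+ k], and
    comparing it with the norms at both ends costs one constant. *)
Lemma joint_spectral_radius_le q : 0 < q -> contracting_weight q ->
  joint_spectral_radius nu <= q.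
Proof.
move=> q0 [w [[C C0 nuw] w_edge]].
have w_walk (u v : vertex xi) (p : walk u v) x :
    w v (walk_op p x) <= q ^+ walk_size p * w u x.
  elim: p x => [{}v|e {}v p IHp] x /=; first by rewrite id_lfunE expr0 mul1r.
  rewrite comp_lfunE exprSr -mulrA; apply: le_trans (IHp _) _.
  by rewrite ler_pM2l ?exprn_gt0.
apply: (lim_root_le max_walk_norm_ge0 max_walk_norm_submul q0 C0) => k.
apply: max_walk_norm_le => [|u v p x <-].
  by rewrite mulr_ge0 ?exprn_ge0// ltW.
have /andP[nu_le _] := nuw v (walk_op p x); apply: le_trans nu_le _.
apply: le_trans (w_walk _ _ _ _) _; rewrite [C * _]mulrC -mulrA.
by rewrite ler_pM2l ?exprn_gt0//; case/andP: (nuw u x).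
Qed.

(** The weight of [x] is the largest norm that [x] can reach along a walk, each
    step being discounted by [q].  Prepending an edge to a walk shows that it
    contracts; the empty walk shows that it dominates the norm. *)
Lemma contracting_weight_exists q : joint_spectral_radius nu < q ->
  contracting_weight q.
Proof.
move=> nu_q; have q0 := le_lt_trans joint_spectral_radius_ge0 nu_q.
have [D D0 walkD] := lim_root_lt max_walk_norm_ge0 max_walk_norm_submul nu_q.
pose E (v : vertex xi) (x : vertex_space v) := [set y | exists u (p : walk v u),
  y = nu u (walk_op p x) / q ^+ walk_size p].
have E_ub v x : ubound (@E v x) (D * nu v x).
  move=> _ [u [p ->]]; rewrite ler_pdivrMr ?exprn_gt0// mulrAC.
  by apply: le_trans (max_walk_normP _ _) _; exact: ler_wpM2r.
have E_nu v x : @E v x (nu v x).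
  by exists v, (walk_nil v); rewrite /= id_lfunE expr0 divr1.
exists (fun v x => sup (@E v x)); split.
  exists D => // v x; apply/andP; split.
    by apply: ub_le_sup => //; exists (D * nu v x).
  by apply: ge_sup => //; exists (nu v x).
move=> e x; apply: ge_sup; first by exists (nu _ (operator e x)).
move=> _ [u [p ->]]; rewrite -ler_pdivrMl//.
apply: ub_le_sup; first by exists (D * nu (src e) x).
exists u, (walk_cons p) => /=; rewrite comp_lfunE exprS invfM.
by rewrite mulrC -!mulrA [_ ^-1 * q^-1]mulrC.
Qed.

End Walks.

Lemma contracting_weight_norm_indep (R : realType) (xi : system R)
    (nu nu' : multinorm xi) (q : R) :
  contracting_weight nu q -> contracting_weight nu' q.
Proof.
have equiv (nu1 nu2 : multinorm xi) :
    exists2 K : R, 0 < K & forall v x, nu1 v x <= K * nu2 v x.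
  apply: uniform_constant => [v C C' CC' BC x|v].
    apply: le_trans (BC x) _; apply: ler_wpM2r => //.
    exact: seminorm_ge0 (norm_on_seminorm _) _.
  exact: seminorm_le_norm (norm_on_seminorm _).
move=> [w [[C C0 nuw] w_edge]].
have [K K0 nuK] := equiv nu' nu; have [K' K'0 nuK'] := equiv nu nu'.
exists (fun v x => K * w v x); split=> [|e x]; last first.
  by rewrite mulrCA ler_pM2l.
exists (K * (C * K')) => [|v x]; first by rewrite !mulr_gt0.
have /andP[nu_w w_nu] := nuw v x; apply/andP; split.
  by apply: le_trans (nuK v x) _; rewrite ler_pM2l.
rewrite -mulrA ler_pM2l//; apply: le_trans w_nu _.
by rewrite -mulrA ler_pM2l.
Qed.

(** * Restricting and gluing weights *)

Section Restrictions.
Variables (R : realType) (xi : system R) (nu : multinorm xi).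

Definition restrict_multinorm (S : {set vertex xi}) :
    multinorm (restriction S) := fun v => nu (val v).

Lemma contracting_weight_restriction S q :
  contracting_weight nu q -> contracting_weight (@restrict_multinorm S) q.
Proof.
move=> [w [[C C0 nuw] w_edge]]; exists (fun v => w (val v)); split.
  by exists C => // v x; exact: nuw.
by move=> e x; exact: w_edge.
Qed.

(** Weights on the vertices of [S] are extended by zero to all vertices, so that
    weights on different parts become functions of the same type. *)
Lemma contracting_weight_extension S q :
  contracting_weight (@restrict_multinorm S) q ->
  exists2 w : forall v : vertex xi, vertex_space v -> R,
    (exists2 C, 0 < C &
       forall v x, v \in S -> nu v x <= w v x <= C * nu v x) &
    (forall e x, src e \in S -> tgt e \in S ->
       w (tgt e) (operator e x) <= q * w (src e) x).
Proof.
move=> [w [[C C0 nuw] w_edge]].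
pose w' (v : vertex xi) : vertex_space v -> R :=
  if pselect (v \in S) is left vS then w (exist _ v vS) else fun=> 0.
have w'E v (vS : v \in S) x : w' v x = w (exist _ v vS) x.
  by rewrite /w'; case: pselect => // vS'; rewrite (bool_irrelevance vS' vS).
exists w' => [|e x srcS tgtS].
  by exists C => // v x vS; rewrite w'E; exact: (nuw (exist _ v vS)).
have eS : (src e \in S) && (tgt e \in S) by rewrite srcS tgtS.
pose e' : inner_edge S := exist _ e eS.
rewrite (w'E _ (proj2 (andP (valP e')))) (w'E _ (proj1 (andP (valP e')))).
exact: (w_edge e').
Qed.

(** Scaling the weight of part [i] by [t ^+ i] with [t] large makes every edge
    that leaves its part contract, since such edges only lower the index. *)
Lemma contracting_weight_glue (r : nat) (P : 'I_r -> {set vertex xi}) q :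
  0 < q -> (forall v, exists i, v \in P i) ->
  (forall (e : edge xi) i j, src e \in P i -> tgt e \in P j -> (j <= i)%N) ->
  (forall i, contracting_weight (@restrict_multinorm (P i)) q) ->
  contracting_weight nu q.
Proof.
move=> q0 P_cover P_edge P_weight.
have nu_ge0 (v : vertex xi) x : 0 <= nu v x.
  exact: seminorm_ge0 (norm_on_seminorm _) _.
have [idx idxP] := choice P_cover.
pose good i C (w : forall v : vertex xi, vertex_space v -> R) :=
  forall v x, v \in P i -> nu v x <= w v x <= C * nu v x.
have /choice[w wP] : forall i,
    exists w : forall v : vertex xi, vertex_space v -> R,
    (exists2 C : R, 0 < C & good i C w) /\
    (forall e x, src e \in P i -> tgt e \in P i ->
       w (tgt e) (operator e x) <= q * w (src e) x).
  move=> i; have [w ? ?] := contracting_weight_extension (P_weight i).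
  by exists w.
have [C C0 goodC] : exists2 C : R, 0 < C & forall i, good i C (w i).
  apply: uniform_constant => [i C C' CC' goodC v x vP|i]; last exact: (wP i).1.
  have /andP[-> wC] := goodC v x vP; apply: le_trans wC _; exact: ler_wpM2r.
have [B B0 edgeB] := edges_bounded nu.
(* [C * B] bounds the ratio of the weights at the two ends of an edge, so an
   edge that lowers the index contracts at rate [q] when [C * B <= t * q]. *)
pose t := Num.max 1 (C * B / q).
have t1 : 1 <= t by rewrite le_max lexx.
have t0 : 0 < t by exact: lt_le_trans t1.
have tq : C * B <= t * q by rewrite -ler_pdivrMr// le_max lexx orbT.
exists (fun v x => t ^+ idx v * w (idx v) v x); split.
  exists (t ^+ r * C) => [|v x]; first by rewrite mulr_gt0// exprn_gt0.
  have /andP[nu_w w_nu] := goodC _ _ x (idxP v).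
  apply/andP; split.
    apply: (le_trans nu_w); rewrite ler_peMl ?exprn_ege1//.
    exact: le_trans nu_w.
  rewrite -mulrA; apply: ler_pM => //.
  - exact/exprn_ge0/ltW.
  - exact: le_trans nu_w.
  - by apply: ler_weXn2l => //; exact/ltnW/ltn_ord.
move=> e x; have srcP := idxP (src e); have tgtP := idxP (tgt e).
have := P_edge e _ _ srcP tgtP.
rewrite leq_eqVlt => /orP[/eqP/ord_inj idx_eq|lt_idx].
  rewrite idx_eq mulrCA ler_pM2l ?exprn_gt0//.
  by apply: (wP _).2 => //; rewrite -idx_eq.
have /andP[_ w_nu] := goodC _ _ (operator e x) tgtP.
have /andP[nu_w _] := goodC _ _ x srcP.
apply: (@le_trans _ _ (t ^+ idx (tgt e) * (t * q * w (idx (src e)) (src e) x))).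
  rewrite ler_pM2l ?exprn_gt0//; apply: le_trans w_nu _.
  apply: (@le_trans _ _ (C * (B * nu (src e) x))); first by rewrite ler_pM2l.
  by rewrite mulrA; apply: ler_pM => //; rewrite mulr_ge0// ltW.
rewrite -mulrA mulrA -exprSr mulrCA ler_pM2l//; apply: ler_wpM2r.
  exact: le_trans nu_w.
exact: ler_weXn2l.
Qed.

End Restrictions.

(** * Strongly connected components *)

Section StronglyConnectedComponents.
Variables (R : realType) (xi : system R).
Implicit Types u v w : vertex xi.

Definition scc v : {set vertex xi} :=
  [set w | reachable v w && reachable w v]%SET.

Lemma reachable_trans u v w : reachable u v -> reachable v w -> reachable u w.
Proof. exact: connect_trans. Qed.

Lemma scc_refl v : v \in scc v.
Proof. by rewrite finset.in_set /reachable connect0. Qed.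

Lemma scc_eq v w : w \in scc v -> scc v = scc w.
Proof.
rewrite finset.in_set => /andP[vw wv]; apply/setP => u; rewrite !finset.in_set.
apply/andP/andP => -[r1 r2]; split.
- exact: reachable_trans r1.
- exact: reachable_trans vw.
- exact: reachable_trans r1.
- exact: reachable_trans wv.
Qed.

(** A path between two vertices of a component never leaves it, since each
    vertex on the path is reached from the first end and reaches the last. *)
Lemma restriction_reachable v (x y : vertex (restriction (scc v))) :
  reachable x y.
Proof.
suff lift_path (p : seq (vertex xi)) (z : vertex (restriction (scc v))) :
    path (@edge_rel R xi) (val z) p -> last (val z) p = val y ->
    connect (@edge_rel R (restriction (scc v))) z y.
  have : reachable (val x) (val y).
    have := valP x; have := valP y.
    rewrite !finset.in_set => /andP[vy _] /andP[_ xv].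
    exact: reachable_trans vy.
  by case/connectP => p pxy /esym; exact: lift_path.
elim: p z => [|b p IHp] z /=; first by move=> _ /val_inj ->.
move=> /andP[/existsP[e /andP[/eqP src_e /eqP tgt_e]] bp] last_b.
have src_scc : src e \in scc v by rewrite src_e; exact: valP.
have b_scc : b \in scc v.
  have := valP z; have := valP y.
  rewrite !finset.in_set => /andP[_ yv] /andP[vz _].
  apply/andP; split.
    apply: reachable_trans vz _; apply: connect1.
    by apply/existsP; exists e; rewrite src_e tgt_e !eqxx.
  by apply: reachable_trans yv; apply/connectP; exists p.
have e_scc : (src e \in scc v) && (tgt e \in scc v).
  by rewrite src_scc tgt_e b_scc.
apply: connect_trans (IHp (exist _ b b_scc) bp last_b); apply: connect1.
apply/existsP; exists (exist _ e e_scc : inner_edge (scc v)).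
by apply/andP; split; apply/eqP/val_inj.
Qed.

Definition reach_card (S : {set vertex xi}) : nat :=
  #|[set w | [exists u in S, reachable u w]]%SET|.

(** Everything reached from [v] is reached from [u], while [u] itself is not
    reached from [v]. *)
Lemma reach_card_lt u v : reachable u v -> ~~ reachable v u ->
  (reach_card (scc v) < reach_card (scc u))%N.
Proof.
move=> uv vu; apply: proper_card; apply/properP; split.
  apply/fintype.subsetP => w; rewrite !finset.in_set => /exists_inP[v' v'v v'w].
  apply/exists_inP; exists u; first exact: scc_refl.
  move: v'v; rewrite finset.in_set => /andP[vv' _].
  exact: reachable_trans uv (reachable_trans vv' v'w).
exists u; rewrite finset.in_set.
  by apply/exists_inP; exists u; [exact: scc_refl | exact: connect0].
apply/exists_inP => -[v' v'v v'u]; move/negP: vu; apply.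
by move: v'v; rewrite finset.in_set => /andP[vv' _]; exact: reachable_trans v'u.
Qed.

(** Sorting the components by increasing [reach_card] orders them, because a
    path between distinct components goes to a smaller [reach_card]. *)
Lemma ordered_scc_partition_exists :
  exists (r : nat) (P : 'I_r -> {set vertex xi}), ordered_scc_partition P.
Proof.
pose le_reach A B := (reach_card A <= reach_card B)%N.
pose s := sort le_reach (enum [set scc v | v in [set: vertex xi]]%SET).
have mem_s A : reflect (exists v, A = scc v) (A \in s).
  rewrite mem_sort mem_enum.
  by apply: (iffP imsetP) => [[v _ ->]|[v ->]]; exists v.
have s_uniq : uniq s by rewrite sort_uniq enum_uniq.
have le_reach_trans : transitive le_reach by move=> ? ? ?; exact: leq_trans.
have s_sorted : sorted le_reach s.
  by apply: sort_sorted => A B; exact: leq_total.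
pose P (i : 'I_(size s)) := nth finset.set0 s i.
have P_scc i v : v \in P i -> P i = scc v.
  have /mem_s[u ->] : P i \in s by exact: mem_nth.
  exact: scc_eq.
have P_inj i j : P i = P j -> i = j.
  move=> /eqP; rewrite nth_uniq// => /eqP; exact: ord_inj.
exists (size s), P; split.
- move=> i; have /mem_s[v ->] : P i \in s by exact: mem_nth.
  by apply/set0Pn; exists v; exact: scc_refl.
- move=> i j /eqP ij; apply/setP => v; rewrite finset.in_setI finset.in_set0.
  apply/negP => /andP[/P_scc Pi /P_scc Pj]; apply: ij; apply: P_inj.
  by rewrite Pi.
- apply/setP => v; rewrite finset.in_setT; apply/bigcupP.
  have sv : scc v \in s by apply/mem_s; exists v.
  have lt_sv : (index (scc v) s < size s)%N by rewrite index_mem.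
  by exists (Ordinal lt_sv); rewrite // /P /= nth_index ?scc_refl.
- move=> i; have /mem_s[v ->] : P i \in s by exact: mem_nth.
  by move=> x y _; split; exact: restriction_reachable.
- move=> i j ji u v uP vP; apply/negP => uv.
  have : le_reach (P j) (P i).
    by apply: (sorted_ltn_nth le_reach_trans); rewrite ?inE.
  rewrite /le_reach (P_scc _ _ uP) (P_scc _ _ vP) leqNgt => /negP; apply.
  apply: reach_card_lt => //; apply/negP => vu.
  have : v \in scc u by rewrite finset.in_set uv.
  move/scc_eq; rewrite -(P_scc _ _ uP) -(P_scc _ _ vP) => /P_inj ij.
  by rewrite ij ltnn in ji.
Qed.

End StronglyConnectedComponents.

(** * The joint spectral radius of a partitioned system *)

(** Both inequalities are checked at rates [q] slightly above the side that is
    to be the larger one, since weights exist there but possibly not at the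
    rate itself. *)
Lemma joint_spectral_radius_partition (R : realType) (xi : system R) (r : nat)
    (P : 'I_r -> {set vertex xi}) (nu : multinorm xi)
    (nu_ : forall i, multinorm (restriction (P i))) :
  (forall v, exists i, v \in P i) ->
  (forall (e : edge xi) i j, src e \in P i -> tgt e \in P j -> (j <= i)%N) ->
  joint_spectral_radius nu =
    \big[Num.max/0]_(i < r) joint_spectral_radius (nu_ i).
Proof.
move=> P_cover P_edge; apply/eqP; rewrite eq_le; apply/andP; split.
  apply/ler_addgt0Pr => e e0; set m := \big[_/_]_(_ < _) _.
  have q0 : 0 < m + e by rewrite ltr_wpDl// bigmax_ge_id.
  apply: joint_spectral_radius_le => //.
  apply: (contracting_weight_glue q0 P_cover P_edge) => i.
  apply: (contracting_weight_norm_indep (nu := nu_ i)).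
  apply: contracting_weight_exists.
  by apply: (@le_lt_trans _ _ m); [exact: le_bigmax | rewrite ltrDl].
apply: bigmax_le => [|i _]; first exact: joint_spectral_radius_ge0.
apply/ler_addgt0Pr => e e0.
have lt_q : joint_spectral_radius nu < joint_spectral_radius nu + e.
  by rewrite ltrDl.
apply: joint_spectral_radius_le.
  by rewrite ltr_wpDl// joint_spectral_radius_ge0.
apply: contracting_weight_norm_indep.
exact/contracting_weight_restriction/contracting_weight_exists/lt_q.
Qed.

Theorem corollary1 (R : realType) (xi : system R)
    (not_sc : ~ strongly_connected xi) :
  (exists (r : nat) (P : 'I_r -> {set vertex xi}), ordered_scc_partition P) /\
  (forall (r : nat) (P : 'I_r -> {set vertex xi}),
     ordered_scc_partition P ->
     forall (nu : multinorm xi)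
            (nu_ : forall i : 'I_r, multinorm (restriction (P i))),
       joint_spectral_radius nu =
         \big[Num.max/0]_(i < r) joint_spectral_radius (nu_ i)).
Proof.
split; first exact: ordered_scc_partition_exists.
move=> r P [_ _ P_cover _ P_order] nu nu_.
apply: joint_spectral_radius_partition => [v|e i j src_i tgt_j].
  have : v \in (\bigcup_(i < r) P i)%SET by rewrite P_cover finset.in_setT.
  by case/bigcupP => i _ vi; exists i.
rewrite leqNgt; apply/negP => lt_ij.
move/negP: (P_order j i lt_ij _ _ src_i tgt_j); apply.
by apply: connect1; apply/existsP; exists e; rewrite !eqxx.
Qed.
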